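(* Let $G$ be a countable group and let $K$ be a field. Then the group algebra $K[G]$ is one-sided Noetherian if and only if $G$ is of $K$-linear Markov type.
   Context: For a finite-dimensional $K$-vector space $A$, $A^G$ is the $K$-vector space of all maps $x \colon G \to A$, equipped with the prodiscrete topology (product topology with each factor $A$ discrete) and with the shift action of $G$ given by $(gx)(h) = x(g^{-1}h)$. A linear subshift of $A^G$ is a closed $G$-invariant vector subspace of $A^G$. A subset $\Sigma \subset A^G$ is a subshift of finite type (SFT) if there exist a finite subset $D \subset G$ and a subset $P \subset A^D$ such that $\Sigma = \{x \in A^G : (g^{-1}x)|_D \in P \text{ for all } g \in G\}$. The group $G$ is of $K$-linear Markov type if, for every finite-dimensional vector space $A$ over $K$, every linear subshift $\Sigma \subset A^G$ is an SFT. The algebra $K[G]$ is isomorphic to its opposite algebra (via $\alpha^*(g) = \alpha(g^{-1})$), so it is left Noetherian if and only if it is right Noetherian; in that case it is called one-sided Noetherian. *)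

(* Defs.v *)
From HB Require Import structures.
From mathcomp Require Import all_boot all_algebra finmap.
From mathcomp.multinomials Require Import monalg.
From mathcomp Require Import boolp classical_sets functions cardinality.
From mathcomp Require Import topology_structure function_spaces.
From mathcomp Require Import discrete_topology.

Set Implicit Arguments.
Unset Strict Implicit.
Unset Printing Implicit Defensive.

Import GRing.Theory.

Local Open Scope fset_scope.
Local Open Scope classical_set_scope.
Local Open Scope ring_scope.

(* The library's convolution product on {malg K[G]} requires a monoid with no
   nontrivial units, hence excludes groups: only its K-module structure is
   reused, through an alias that carries the group algebra product. *)
Definition group_algebra (K : fieldType) (G : groupType) : Type := {malg K[G]}.

Section GroupAlgebra.
Variables (K : fieldType) (G : groupType).

HB.instance Definition _ := GRing.Lmodule.copy (group_algebra K G) {malg K[G]}.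

Implicit Types a b c : {malg K[G]}.

Definition ga_one : {malg K[G]} := << 1 *g 1%g >>.

Definition ga_mul a b : {malg K[G]} :=
  \sum_(g <- msupp a) \sum_(h <- msupp b) << a@_g * b@_h *g (g * h)%g >>.

Lemma ga_mulw (d1 d2 : {fset G}) a b :
  (msupp a `<=` d1)%fset -> (msupp b `<=` d2)%fset ->
  ga_mul a b = \sum_(g <- d1) \sum_(h <- d2) << a@_g * b@_h *g (g * h)%g >>.
Proof.
move=> le_d1 le_d2; rewrite /ga_mul (big_fset_incl _ le_d1) /=.
  apply/eq_bigr=> g _; apply/big_fset_incl => // h _ /mcoeff_outdom ->.
  by rewrite mulr0 monalgU0.
move=> g _ /mcoeff_outdom ag.
by rewrite big1 => // h _; rewrite ag mul0r monalgU0.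
Qed.

Lemma ga_mul0l : left_zero 0 ga_mul.
Proof. by move=> a; rewrite /ga_mul msupp0 big_seq_fset0. Qed.

Lemma ga_mul0r : right_zero 0 ga_mul.
Proof.
by move=> a; rewrite /ga_mul big1 // => g _; rewrite msupp0 big_seq_fset0.
Qed.

Lemma ga_mulDl : left_distributive ga_mul +%R.
Proof.
move=> a b c.
rewrite (ga_mulw (msuppD_le a b) (fsubset_refl _)).
rewrite (ga_mulw (fsubsetUl (msupp a) (msupp b)) (fsubset_refl (msupp c))).
rewrite (ga_mulw (fsubsetUr (msupp a) (msupp b)) (fsubset_refl (msupp c))).
rewrite -big_split /=; apply/eq_bigr=> g _.
rewrite -big_split /=; apply/eq_bigr=> h _.
by rewrite mcoeffD mulrDl monalgUD.
Qed.

Lemma ga_mulDr : right_distributive ga_mul +%R.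
Proof.
move=> a b c.
rewrite (ga_mulw (fsubset_refl _) (msuppD_le b c)).
rewrite (ga_mulw (fsubset_refl (msupp a)) (fsubsetUl (msupp b) (msupp c))).
rewrite (ga_mulw (fsubset_refl (msupp a)) (fsubsetUr (msupp b) (msupp c))).
rewrite -big_split /=; apply/eq_bigr=> g _.
rewrite -big_split /=; apply/eq_bigr=> h _.
by rewrite mcoeffD mulrDr monalgUD.
Qed.

Lemma ga_mulUU (x y : K) (g h : G) :
  ga_mul << x *g g >> << y *g h >> = << x * y *g (g * h)%g >>.
Proof. by rewrite (ga_mulw msuppU_le msuppU_le) !big_seq_fset1 !mcoeffUU. Qed.

Lemma ga_mul_suml (I : Type) (r : seq I) (F : I -> {malg K[G]}) b :
  ga_mul (\sum_(i <- r) F i) b = \sum_(i <- r) ga_mul (F i) b.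
Proof.
exact: (big_morph (ga_mul^~ b) (fun _ _ => ga_mulDl _ _ _) (ga_mul0l b)).
Qed.

Lemma ga_mul_sumr (I : Type) (r : seq I) (F : I -> {malg K[G]}) a :
  ga_mul a (\sum_(i <- r) F i) = \sum_(i <- r) ga_mul a (F i).
Proof.
exact: (big_morph (ga_mul a) (fun _ _ => ga_mulDr _ _ _) (ga_mul0r a)).
Qed.

Lemma ga_mul1l : left_id ga_one ga_mul.
Proof.
move=> a; rewrite [in LHS](monalgE a) ga_mul_sumr [RHS]monalgE.
by apply: eq_bigr => g _; rewrite ga_mulUU mul1r mul1g.
Qed.

Lemma ga_mul1r : right_id ga_one ga_mul.
Proof.
move=> a; rewrite [in LHS](monalgE a) ga_mul_suml [RHS]monalgE.
by apply: eq_bigr => g _; rewrite ga_mulUU mulr1 mulg1.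
Qed.

Lemma ga_mulA : associative ga_mul.
Proof.
move=> a b c; rewrite (monalgE a) !ga_mul_suml; apply: eq_bigr => g _.
rewrite (monalgE b) ga_mul_suml !ga_mul_sumr ga_mul_suml.
apply: eq_bigr => h _.
rewrite (monalgE c) !ga_mul_sumr; apply: eq_bigr => k _.
by rewrite !ga_mulUU mulrA mulgA.
Qed.

Lemma ga_one_neq0 : ga_one != 0.
Proof. by apply/eqP/malgP=> /(_ 1%g) /eqP; rewrite !mcoeffsE oner_eq0. Qed.

Lemma ga_mulCl (x : K) a : ga_mul << x *g 1%g >> a = x *: a.
Proof.
apply/malgP => h; rewrite mcoeffZ [in LHS](monalgE a) ga_mul_sumr.
rewrite [in RHS](monalgE a) !raddf_sum /= mulr_sumr.
by apply: eq_bigr => g _; rewrite ga_mulUU mul1g !mcoeffU mulrnAr.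
Qed.

Lemma ga_mulCr (x : K) a : ga_mul a << x *g 1%g >> = x *: a.
Proof.
rewrite -ga_mulCl (monalgE a) ga_mul_suml ga_mul_sumr.
by apply: eq_bigr => g _; rewrite !ga_mulUU mul1g mulg1 mulrC.
Qed.

Lemma ga_scaleAl (x : K) a b : x *: ga_mul a b = ga_mul (x *: a) b.
Proof. by rewrite -!ga_mulCl ga_mulA. Qed.

Lemma ga_scaleAr (x : K) a b : x *: ga_mul a b = ga_mul a (x *: b).
Proof. by rewrite -!ga_mulCr ga_mulA. Qed.

HB.instance Definition _ := GRing.Zmodule_isNzRing.Build (group_algebra K G)
  ga_mulA ga_mul1l ga_mul1r ga_mulDl ga_mulDr ga_one_neq0.

HB.instance Definition _ :=
  GRing.Lmodule_isLalgebra.Build K (group_algebra K G) ga_scaleAl.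

HB.instance Definition _ :=
  GRing.Lalgebra_isAlgebra.Build K (group_algebra K G) ga_scaleAr.

End GroupAlgebra.

Section Noetherian.
Variable R : nzRingType.

Definition left_ideal (I : set R) : Prop :=
  [/\ I 0, forall x y, I x -> I y -> I (x + y) & forall r x, I x -> I (r * x)].

Definition right_ideal (I : set R) : Prop :=
  [/\ I 0, forall x y, I x -> I y -> I (x + y) & forall r x, I x -> I (x * r)].

Definition ascending_chain_condition (ideal : set R -> Prop) : Prop :=
  forall I : nat -> set R, (forall n, ideal (I n)) ->
    (forall n, I n `<=` I n.+1) ->
    exists n, forall m, (n <= m)%N -> I m = I n.

Definition left_noetherian : Prop := ascending_chain_condition left_ideal.

Definition right_noetherian : Prop := ascending_chain_condition right_ideal.

(* For group algebras the two disjuncts are equivalent, see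
   group_algebra_left_right_noetherian. *)
Definition one_sided_noetherian : Prop := left_noetherian \/ right_noetherian.

End Noetherian.

Section Opposite.
Variables (K : fieldType) (G : groupType).

Definition ga_star (a : group_algebra K G) : group_algebra K G :=
  \sum_(g <- msupp a) << (a : {malg K[G]})@_g *g g^-1%g >>.

Lemma ga_starE (a : group_algebra K G) (g : G) :
  mcoeff g (ga_star a) = mcoeff g^-1%g a.
Proof.
rewrite /ga_star raddf_sum /= [in RHS](monalgE a) raddf_sum /=.
apply: eq_bigr => h _; rewrite !mcoeffU; congr (_ *+ nat_of_bool _).
by apply/eqP/eqP => [<-|->]; rewrite invgK.
Qed.

Lemma ga_starD : {morph ga_star : a b / a + b}.
Proof.
by move=> a b; apply/malgP => g; rewrite mcoeffD !ga_starE mcoeffD.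
Qed.

Lemma ga_star0 : ga_star 0 = 0.
Proof. by apply/malgP => g; rewrite ga_starE !mcoeff0. Qed.

Lemma ga_starK : involutive ga_star.
Proof. by move=> a; apply/malgP => g; rewrite !ga_starE invgK. Qed.

Lemma ga_starU (x : K) (g : G) :
  ga_star (<< x *g g >> : {malg K[G]}) = << x *g g^-1%g >>.
Proof.
apply/malgP => h; rewrite ga_starE !mcoeffU; congr (_ *+ nat_of_bool _).
by apply/eqP/eqP => [->|<-]; rewrite invgK.
Qed.

Lemma ga_star_sum (I : Type) (r : seq I) (F : I -> {malg K[G]}) :
  ga_star (\sum_(i <- r) F i) = \sum_(i <- r) (ga_star (F i) : {malg K[G]}).
Proof. exact: (big_morph ga_star ga_starD ga_star0). Qed.

Lemma ga_starM (a b : group_algebra K G) :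
  ga_star (a * b) = ga_star b * ga_star a.
Proof.
change (ga_star (ga_mul a b) = ga_mul (ga_star b) (ga_star a)).
rewrite (monalgE a) !(ga_mul_suml, ga_star_sum, ga_mul_sumr).
apply: eq_bigr => g _.
rewrite (monalgE b) !(ga_mul_sumr, ga_star_sum, ga_mul_suml).
apply: eq_bigr => h _.
by rewrite ga_mulUU !ga_starU ga_mulUU mulrC invgM.
Qed.

Let star_preim (I : set (group_algebra K G)) := ga_star @^-1` I.

Let star_preimK : involutive star_preim.
Proof. by move=> I; apply/seteqP; split=> a; rewrite /star_preim /= ga_starK. Qed.

Lemma acc_transfer (id1 id2 : set (group_algebra K G) -> Prop) :
  (forall I, id2 I -> id1 (star_preim I)) ->
  ascending_chain_condition id1 -> ascending_chain_condition id2.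
Proof.
move=> id21 acc I idI incI.
have [n nP] := acc (fun n => star_preim (I n)) (fun n => id21 _ (idI n))
  (fun n a => incI n (ga_star a)).
exists n => m /nP eqI.
by rewrite -[LHS]star_preimK eqI star_preimK.
Qed.

Lemma group_algebra_left_right_noetherian :
  left_noetherian (group_algebra K G) <-> right_noetherian (group_algebra K G).
Proof.
split; apply: acc_transfer => I [I0 ID IM]; split; rewrite /star_preim /=.
- by rewrite ga_star0.
- by move=> a b Ia Ib; rewrite ga_starD; apply: ID.
- by move=> r a Ia; rewrite ga_starM; apply: IM.
- by rewrite ga_star0.
- by move=> a b Ia Ib; rewrite ga_starD; apply: ID.
- by move=> r a Ia; rewrite ga_starM; apply: IM.
Qed.

End Opposite.

Section Subshifts.
Variables (K : fieldType) (G : groupType) (A : vectType K).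

Definition shift (g : G) (x : G -> A) : G -> A := fun h => x (g^-1 * h)%g.

Definition prodiscrete_closed (S : set (G -> A)) : Prop :=
  closed (S : set {ptws G -> discrete_topology A}).

Definition linear_subshift (S : set (G -> A)) : Prop :=
  [/\ prodiscrete_closed S,
      forall g x, S x -> S (shift g x),
      S 0,
      forall x y, S x -> S y -> S (x + y)
    & forall (c : K) x, S x -> S (c *: x)].

Definition is_sft (S : set (G -> A)) : Prop :=
  exists (D : {fset G}) (P : set (D -> A)),
    S = [set x | forall g : G, P (fun d : D => shift g^-1%g x (val d))].

End Subshifts.

Definition linear_markov_type (K : fieldType) (G : groupType) : Prop :=
  forall (A : vectType K) (S : set (G -> A)), linear_subshift S -> is_sft S.

(* Main.v *)
(** Fix coordinates on A. A row f in K[G]^n, n = dim A, pairs with a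
    configuration x : G -> A by <f, x> = sum_i sum_g f_i(g) x_i(g), and
    <r f, x> = sum_g r(g) <f, g^-1 x>: rows are linear equations on
    configurations. Linear functionals on K[G]^n are the pairings with
    configurations, so a submodule N of K[G]^n is the annihilator of its zero
    locus, which is a linear subshift. Linear functionals on A^G depending only
    on the coordinates in a finite window D are the pairings with the rows
    supported in D, so the equations of a linear subshift S supported in D cut
    out the configurations that agree on D with an element of S.

    Consequently S is of finite type if and only if its annihilator is finitely
    generated: a finite-type window D makes the equations supported in D, which
    form a finite-dimensional space, generate all of them; conversely the
    supports of finitely many generators lie in one window. Hence all linear
    subshifts of A^G are of finite type if and only if all submodules of K[G]^n
    are finitely generated. *)

Require Import Defs.
From HB Require Import structures.
From mathcomp Require Import all_boot all_algebra finmap.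
From mathcomp.multinomials Require Import monalg.
From mathcomp Require Import boolp classical_sets functions cardinality.
From mathcomp Require Import topology_structure function_spaces.
From mathcomp Require Import discrete_topology supremum_topology.

Set Implicit Arguments.
Unset Strict Implicit.
Unset Printing Implicit Defensive.

Import GRing.Theory.

Local Open Scope fset_scope.
Local Open Scope classical_set_scope.
Local Open Scope ring_scope.

Definition directed (I T : Type) (D : set I) (N : I -> set T) : Prop :=
  forall i j, D i -> D j -> exists2 k, D k & N i `|` N j `<=` N k.

Lemma seq_subset_bigcup (I : Type) (T : eqType) (D : set I) (N : I -> set T)
    (s : seq T) :
  D !=set0 -> directed D N -> [set` s] `<=` \bigcup_(i in D) N i ->
  exists2 i, D i & [set` s] `<=` N i.
Proof.
move=> [i0 Di0] dirN; elim: s => [|u s IHs] sN; first by exists i0.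
have [v vs|i Di sNi] := IHs; first by apply: sN; rewrite /= inE vs orbT.
have [|j Dj Nju] := sN u; first by rewrite /= mem_head.
have [k Dk ijk] := dirN _ _ Di Dj.
exists k => // v; rewrite /= inE => /predU1P[->|vs]; apply: ijk.
- by right.
- by left; apply: sNi.
Qed.

Lemma total_on_directed (T : Type) (F : set (set T)) (f : set T -> set T) :
  total_on F subset -> {homo f : X Y / X `<=` Y} -> directed F f.
Proof.
move=> Ftot fS X Y FX FY; have [XY|YX] := Ftot _ _ FX FY.
- by exists Y => //; rewrite subUset; split=> //; apply: fS.
- by exists X => //; rewrite subUset; split=> //; apply: fS.
Qed.

Lemma seq_subset_image (S T : eqType) (f : S -> T) (A : set S) (t : seq T) :
  [set` t] `<=` f @` A -> exists2 s, [set` s] `<=` A & t = map f s.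
Proof.
elim: t => [|y t IHt] tA; first by exists [::].
have [z zt|s sA ->] := IHt; first by apply: tA; rewrite /= inE zt orbT.
have [|x Ax fx] := tA y; first by rewrite /= mem_head.
exists (x :: s); last by rewrite /= fx.
by move=> z; rewrite /= inE => /predU1P[->|/sA].
Qed.

Definition submodule {R : nzRingType} {U : lmodType R} (N : set U) : Prop :=
  [/\ N 0, forall u v, N u -> N v -> N (u + v) & forall r u, N u -> N (r *: u)].

Section Submodule.
Variable R : nzRingType.
Implicit Types U V : lmodType R.

Lemma submoduleB U (N : set U) u v : submodule N -> N u -> N v -> N (u - v).
Proof.
by case=> _ ND NZ Nu Nv; rewrite -scaleN1r; apply: ND => //; apply: NZ.
Qed.

Lemma submoduleI U (M N : set U) :
  submodule M -> submodule N -> submodule (M `&` N).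
Proof.
move=> [M0 MD MZ] [N0 ND NZ]; split=> // [u v [Mu Nu] [Mv Nv]|r u [Mu Nu]].
- by split; [apply: MD|apply: ND].
- by split; [apply: MZ|apply: NZ].
Qed.

Lemma submodule_preimage U V (f : {linear U -> V}) (N : set V) :
  submodule N -> submodule (f @^-1` N).
Proof.
move=> [N0 ND NZ]; split=> [|u v Nu Nv|r u Nu] /=.
- by rewrite linear0.
- by rewrite linearD; apply: ND.
- by rewrite linearZ; apply: NZ.
Qed.

Lemma submodule_ker U V (f : {linear U -> V}) : submodule (f @^-1` [set 0]).
Proof.
by apply: submodule_preimage; split=> // [u v -> ->|r u ->];
  rewrite ?addr0 ?scaler0.
Qed.

Lemma submodule_image U V (f : {linear U -> V}) (N : set U) :
  submodule N -> submodule (f @` N).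
Proof.
move=> [N0 ND NZ]; split=> [|_ _ [u Nu <-] [v Nv <-]|r _ [u Nu <-]].
- by exists 0; rewrite ?linear0.
- by exists (u + v); rewrite ?linearD//; apply: ND.
- by exists (r *: u); rewrite ?linearZ//; apply: NZ.
Qed.

Lemma submodule_bigcup U (I : Type) (D : set I) (N : I -> set U) :
  D !=set0 -> directed D N -> (forall i, D i -> submodule (N i)) ->
  submodule (\bigcup_(i in D) N i).
Proof.
move=> [i0 Di0] dirN subN; split=> [|u v [i Di Nu] [j Dj Nv]|r u [i Di Nu]].
- by exists i0 => //; case: (subN _ Di0).
- have [k Dk ijk] := dirN _ _ Di Dj; exists k => //.
  by case: (subN _ Dk) => _ ND _; apply: ND; apply: ijk; [left|right].
- by exists i => //; case: (subN _ Di) => _ _; apply.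
Qed.

Lemma submodule_smallest U (X : set U) : submodule (smallest submodule X).
Proof.
split=> [N [[]]//|u v Xu Xv N subXN|r u Xu N subXN].
- by case: (subXN) => -[_ ND _] _; apply: ND; [apply: Xu|apply: Xv].
- by case: (subXN) => -[_ _ NZ] _; apply: NZ; apply: Xu.
Qed.

Definition adjoin U (N : set U) (u : U) : set U :=
  [set w | exists a, N (w - a *: u)].

Lemma sub_adjoin U (N : set U) u : N `<=` adjoin N u.
Proof. by move=> w Nw; exists 0; rewrite scale0r subr0. Qed.

Lemma adjoin_gen U (N : set U) u : submodule N -> adjoin N u u.
Proof. by case=> N0 _ _; exists 1; rewrite scale1r subrr. Qed.

Lemma submodule_adjoin U (N : set U) u : submodule N -> submodule (adjoin N u).
Proof.
move=> subN; have [N0 ND NZ] := subN; split; first exact: sub_adjoin.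
- move=> w z [a Na] [b Nb]; exists (a + b).
  by rewrite scalerDl opprD addrACA; apply: ND.
- by move=> r w [a Na]; exists (r * a); rewrite -scalerA -scalerBr; apply: NZ.
Qed.

Definition maximal_avoiding U (v : U) (H : set U) : Prop :=
  [/\ submodule H, ~ H v &
    forall J, submodule J -> H `<=` J -> ~ J v -> J `<=` H].

Lemma exists_maximal_avoiding U (W : set U) v :
  submodule W -> ~ W v -> exists2 H, W `<=` H & maximal_avoiding v H.
Proof.
move=> subW Wv.
pose avoiding X := submodule (W `|` X) /\ ~ (W `|` X) v.
have [F FP Ftot|A [[subWA WAv] maxA]] := @Zorn_bigcup U avoiding.
  (* The chain F may be empty: set0 is added to it. *)
  have F0P X : (set0 |` F) X -> avoiding X.
    by move=> [->|/FP//]; rewrite /avoiding setU0.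
  have F0tot : total_on (set0 |` F) subset.
    by move=> X Y [->|FX] [->|FY]; [left|left|right|apply: Ftot].
  have F0 : set0 |` F !=set0 by exists set0; left.
  rewrite -[\bigcup_(X in F) X]set0U -bigcup_setU1 /avoiding -bigcupUr//.
  split; last by move=> [X /F0P[]].
  apply: submodule_bigcup => // [|X /F0P[]//].
  by apply: total_on_directed => // X Y; apply: setUS.
exists (W `|` A); first exact: subsetUl.
split=> // J subJ; rewrite subUset => -[WJ AJ] Jv.
apply: contrapT => nJA; apply: (maxA J).
  by split=> // JA; apply: nJA => w /JA; right.
by rewrite /avoiding setUidr.
Qed.

End Submodule.

Section SeparatingFunctional.
Variables (K : fieldType) (V : lmodType K).
Implicit Types (H W : set V) (u v : V).

Lemma maximal_avoiding_adjoin H v :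
  maximal_avoiding v H -> forall u, adjoin H v u.
Proof.
move=> [subH Hv maxH] u; have [_ _ HZ] := subH.
have [[a Ha]|Huv] := pselect (adjoin H u v); last first.
  apply: sub_adjoin; apply: maxH Huv _ _; [exact: submodule_adjoin|..].
  - exact: sub_adjoin.
  - exact: adjoin_gen.
have a0 : a != 0.
  by apply: contra_not_neq Hv => a0; rewrite a0 scale0r subr0 in Ha.
exists a^-1; have := HZ (- a^-1) _ Ha.
by rewrite scalerBr scalerA mulNr mulVf // scaleN1r opprK scaleNr addrC.
Qed.

Lemma adjoin_coef_uniq H v u c d :
  submodule H -> ~ H v -> H (u - c *: v) -> H (u - d *: v) -> c = d.
Proof.
move=> subH Hv Hc Hd; apply: contrapT => /eqP cd; apply: Hv.
have := submoduleB subH Hd Hc; rewrite opprB addrC addrA subrK -scalerBl.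
case: subH => _ _ HZ /(HZ (c - d)^-1).
by rewrite scalerA mulVf ?subr_eq0 ?scale1r.
Qed.

(* A maximal subspace H containing W and avoiding v is a hyperplane, and the
   functional reads the coefficient of v off the decomposition V = H + K v. *)
Lemma exists_separating_functional W v :
  submodule W -> ~ W v ->
  exists2 phi : {scalar V}, W `<=` phi @^-1` [set 0] & phi v = 1.
Proof.
move=> subW Wv; have [H WH maxH] := exists_maximal_avoiding subW Wv.
have [subH Hv _] := maxH; have [H0 HD HZ] := subH.
have [f fP] := choice (maximal_avoiding_adjoin maxH).
have f_eq u c : H (u - c *: v) -> f u = c.
  by move=> Hc; apply: (adjoin_coef_uniq subH Hv (fP u)).
have f_linear : scalar f.
  move=> a x y; apply: f_eq; rewrite scalerDl opprD addrACA -scalerA -scalerBr.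
  by apply: HD; [apply: HZ|].
pose phi : {scalar V} := HB.pack f (GRing.isLinear.Build K V K *%R f f_linear).
exists phi => [w Ww|].
- by apply: f_eq; rewrite scale0r subr0; apply: WH.
- by apply: f_eq; rewrite scale1r subrr.
Qed.

End SeparatingFunctional.

Definition finitely_generated (R : nzRingType) (U : lmodType R) (N : set U) :
    Prop :=
  exists s : seq U, N = smallest submodule [set` s].

Definition noetherian_module (R : nzRingType) (U : lmodType R) : Prop :=
  forall N : set U, submodule N -> finitely_generated N.

Section Noetherian.
Variable R : nzRingType.
Implicit Types U V : lmodType R.

Lemma finitely_generated_image U V (f : {linear U -> V}) (N : set U) :
  finitely_generated N -> finitely_generated (f @` N).
Proof.
move=> [s ->]; exists (map f s); apply/seteqP; split.
- apply/image_subP; apply: smallest_sub => [|u us].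
    by apply: submodule_preimage; apply: submodule_smallest.
  by apply: sub_gen_smallest; apply: map_f.
- apply: smallest_sub => [|_ /mapP[u us ->]].
    by apply: submodule_image; apply: submodule_smallest.
  by exists u => //; apply: sub_gen_smallest.
Qed.

Lemma finitely_generated_extension U V (f : {linear U -> V}) (N : set U) :
  submodule N -> finitely_generated (f @` N) ->
  finitely_generated (N `&` f @^-1` [set 0]) -> finitely_generated N.
Proof.
move=> subN [t fNt] [s kers].
have [|l lN tl] := @seq_subset_image _ _ f N t; first by rewrite fNt.
have [sN _] : [set` s] `<=` N /\ [set` s] `<=` f @^-1` [set 0].
  by rewrite -subsetI kers.
exists (l ++ s); set J := smallest _ _; have subJ : submodule J.
  exact: submodule_smallest.
have [lJ sJ] : [set` l] `<=` J /\ [set` s] `<=` J.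
  by split=> u us; apply: sub_gen_smallest; rewrite /= mem_cat us ?orbT.
have JN : J `<=` N.
  by apply: smallest_sub => // u; rewrite /= mem_cat => /orP[/lN|/sN].
have kerJ : N `&` f @^-1` [set 0] `<=` J by rewrite kers; apply: smallest_sub.
have fNJ : f @` N `<=` f @` J.
  rewrite fNt tl; apply: smallest_sub => [|_ /mapP[u ul ->]].
    exact: submodule_image.
  by exists u => //; apply: lJ.
apply/seteqP; split=> // u Nu; have [w Jw fw] := fNJ _ (imageP f Nu).
rewrite -[u](subrK w); case: (subJ) => _ JD _; apply: JD => //; apply: kerJ.
by split; [apply: submoduleB => //; apply: JN|rewrite /= linearB fw subrr].
Qed.

Lemma finitely_generated_coords U (T : eqType) (p : T -> {linear U -> R^o})
    (ts : seq T) (N : set U) :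
  noetherian_module R^o -> submodule N ->
  (forall u, N u -> {in ts, forall t, p t u = 0} -> u = 0) ->
  finitely_generated N.
Proof.
move=> noethR; elim: ts => [|t ts IHts] in N * => subN N0.
  exists [::]; apply/seteqP; split=> [u /N0 ->//|].
    by case: (submodule_smallest [set` Nil U]).
  exact: smallest_sub.
apply: (@finitely_generated_extension _ _ (p t)) => //.
  by apply/noethR/submodule_image.
apply: IHts => [|u [Nu ptu] pu].
  exact: submoduleI (submodule_ker _).
by apply: N0 => // z; rewrite inE => /predU1P[->|/pu].
Qed.

Definition row_entry n (i : 'I_n) (u : 'rV[R]_n) : R^o := u 0 i.

Fact row_entry_linear n (i : 'I_n) : linear (row_entry i).
Proof. by move=> r u v; rewrite /row_entry !mxE. Qed.

HB.instance Definition _ n (i : 'I_n) :=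
  GRing.isLinear.Build R 'rV[R]_n R^o *:%R (row_entry i) (row_entry_linear i).

Lemma noetherian_row n : noetherian_module R^o -> noetherian_module 'rV[R]_n.
Proof.
move=> noethR N subN.
apply: (@finitely_generated_coords _ _ (@row_entry n) (enum 'I_n)) => // u _ u0.
by apply/rowP => i; rewrite mxE; apply: u0; rewrite mem_enum.
Qed.

Lemma noetherian_row_entry n (i : 'I_n) :
  noetherian_module 'rV[R]_n -> noetherian_module R^o.
Proof.
move=> noeth I subI.
have -> : I = row_entry i @` (row_entry i @^-1` I).
  rewrite image_preimage //; apply/seteqP; split=> // r _.
  by exists (const_mx r); rewrite // /row_entry mxE.
by apply: finitely_generated_image; apply: noeth; apply: submodule_preimage.
Qed.

Lemma left_noetherian_finitely_generated (I : set R^o) :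
  left_noetherian R -> submodule I -> finitely_generated I.
Proof.
move=> noeth subI; apply: contrapT => nfgI.
pose span (s : seq R^o) := smallest submodule [set` s].
have grow s : exists x, [set` s] `<=` I -> I x /\ ~ span s x.
  have [sI|] := pselect ([set` s] `<=` I); last by exists 0.
  apply: contrapT => /forallNP nogrow; apply: nfgI; exists s.
  apply/seteqP; split; last exact: smallest_sub.
  by move=> x Ix; apply: contrapT => sx; apply: (nogrow x).
have [next nextP] := choice grow.
pose s n := iter n (fun s => next s :: s) [::].
have sI n : [set` s n] `<=` I.
  elim: n => //= n IHn u; rewrite /= inE => /predU1P[->|/IHn//].
  by case: (nextP _ IHn).
have [|n sn] := noeth (span \o s) (fun n => submodule_smallest [set` s n]).
  move=> n; apply: smallest_sub; first exact: submodule_smallest.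
  by move=> u us; apply: sub_gen_smallest; rewrite /= inE us orbT.
have [_] := nextP _ (sI n); apply; rewrite -[span _](sn n.+1 (leqnSn n)).
by apply: sub_gen_smallest; rewrite /= mem_head.
Qed.

Lemma left_noetherianP : left_noetherian R <-> noetherian_module R^o.
Proof.
split=> [noeth I|noethR I ideal_I incrI].
  exact: left_noetherian_finitely_generated.
have {}incrI m n : (m <= n)%N -> I m `<=` I n.
  by apply: (homo_leq (@subset_refl _) (@subset_trans _)).
have dirI : directed setT I.
  move=> m n _ _; exists (maxn m n) => //; rewrite subUset.
  by split; apply: incrI; rewrite ?leq_maxl ?leq_maxr.
have N0 : [set: nat] !=set0 by exists 0%N.
have subI : submodule (\bigcup_n I n : set R^o).
  by apply: (@submodule_bigcup _ R^o) => // n _; apply: ideal_I.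
have [s Us] := noethR _ subI.
have [|n _ sn] := seq_subset_bigcup N0 dirI (s := s).
  by rewrite Us; apply: sub_gen_smallest.
exists n => m le_nm; apply/seteqP; split; last exact: incrI.
have /subset_trans : I m `<=` \bigcup_k I k by move=> x Ix; exists m.
by apply; rewrite Us; apply: smallest_sub sn; apply: ideal_I.
Qed.

End Noetherian.

Lemma noetherian_field (K : fieldType) : noetherian_module K^o.
Proof.
move=> I subI; have [[x Ix x0]|I_0] := pselect (exists2 x, I x & x != 0).
  exists [:: x]; apply/seteqP; split=> [y _|]; last first.
    by apply: smallest_sub => // y; rewrite /= inE => /eqP->.
  case: (submodule_smallest [set` [:: x]]) => _ _ XZ; rewrite -[y](mulfVK x0).
  by apply: XZ; apply: sub_gen_smallest; rewrite /= mem_head.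
exists [::]; apply/seteqP; split=> [y Iy|]; last exact: smallest_sub.
have -> : y = 0 by apply: contrapT => /eqP y0; apply: I_0; exists y.
by case: (submodule_smallest [set` Nil K^o]).
Qed.

(* Rows over K[G] are a module over K[G] only; their structure of K-vector space
   is recovered by restriction of scalars. *)
Definition restrict_scalars (K : nzRingType) (R : lalgType K)
    (M : lmodType R) : Type := M.

Section RestrictScalars.
Variables (K : nzRingType) (R : lalgType K) (M : lmodType R).

HB.instance Definition _ := GRing.Zmodule.on (restrict_scalars M).

Definition restrict_scale (c : K) (u : restrict_scalars M) :
  restrict_scalars M := c%:A *: (u : M).

Fact restrict_scaleA c d u :
  restrict_scale c (restrict_scale d u) = restrict_scale (c * d) u.
Proof. by rewrite /restrict_scale scalerA mulr_algl scalerA. Qed.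

Fact restrict_scale1 : left_id 1 restrict_scale.
Proof. by move=> u; rewrite /restrict_scale !scale1r. Qed.

Fact restrict_scaleDr : right_distributive restrict_scale +%R.
Proof. by move=> c u v; apply: scalerDr. Qed.

Fact restrict_scaleDl u : {morph restrict_scale^~ u : c d / c + d}.
Proof. by move=> c d; rewrite /restrict_scale !scalerDl. Qed.

HB.instance Definition _ :=
  GRing.Zmodule_isLmodule.Build K (restrict_scalars M)
    restrict_scaleA restrict_scale1 restrict_scaleDr restrict_scaleDl.

Lemma submodule_restrict (N : set M) :
  submodule N -> submodule (N : set (restrict_scalars M)).
Proof. by case=> N0 ND NZ; split=> // c u; apply: NZ. Qed.

End RestrictScalars.

Section Saturation.
Variables (I : choiceType) (T : Type).
Implicit Types (D : {fset I}) (x : I -> T) (S : set (I -> T)).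

Definition cylinder D x : set (I -> T) := [set y : I -> T | {in D, y =1 x}].

Definition saturation D S : set (I -> T) :=
  [set x | S `&` cylinder D x !=set0].

Lemma sub_saturation D S : S `<=` saturation D S.
Proof. by move=> x Sx; exists x. Qed.

End Saturation.

Lemma submodule_saturation (R : nzRingType) (U : lmodType R) (I : choiceType)
    (D : {fset I}) (S : set (I -> U)) :
  submodule S -> submodule (saturation D S).
Proof.
move=> [S0 SD SZ]; split=> [|x y [u [Su ux]] [v [Sv vy]]|c x [u [Su ux]]].
- exact: sub_saturation.
- exists (u + v); split; first exact: SD.
  by move=> i iD; rewrite addrfctE ux ?vy.
- exists (c *: u); split; first exact: SZ.
  by move=> i iD; rewrite scalrfctE ux.
Qed.

Definition prodiscrete (I T : choiceType) : topologicalType :=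
  {ptws I -> discrete_topology T}.

Lemma nbhs_prodiscreteP (I T : choiceType) (x : prodiscrete I T)
    (B : set (I -> T)) :
  nbhs x B <-> exists D, cylinder D x `<=` B.
Proof.
split=> [|[D DB]].
  have FF : Filter (filter_from [set: {fset I}] (fun D => cylinder D x)).
    apply: filter_from_filter; first by exists fset0.
    move=> D E _ _; exists (D `|` E)%fset => // y yx.
    by split=> i iD; apply: yx; rewrite inE iD ?orbT.
  suff cvgx : filter_from [set: {fset I}] (fun D => cylinder D x) --> x.
    by move=> /cvgx[D _ DB]; exists D.
  apply/cvg_sup => i C /= [_ [[C' _ <-] C'x] C'C].
  by exists [fset i] => // y yx; apply: C'C; rewrite /= yx ?inE.
suff : nbhs x (\bigcap_(i in [set` D]) [set y : I -> T | y i = x i]).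
  by apply: filterS => y yx; apply: DB => i /yx.
apply: filter_bigI => i _.
exact: (@proj_continuous I (fun _ => discrete_topology T) i x [set x i]
  (discrete_set1 _)).
Qed.

Definition single (I : eqType) (U : zmodType) (i : I) (u : U) : I -> U :=
  fun j => if j == i then u else 0.

Fact single_linear (R : nzRingType) (I : eqType) (U : lmodType R) (i : I) :
  linear (@single I U i).
Proof.
move=> c u v; apply/funext => j; rewrite addrfctE scalrfctE /single.
by case: eqP => _; rewrite ?scaler0 ?addr0.
Qed.

HB.instance Definition _ (R : nzRingType) (I : eqType) (U : lmodType R)
    (i : I) :=
  GRing.isLinear.Build R U (I -> U) *:%R (@single I U i) (single_linear i).

Lemma additive_local_sum_single (I : choiceType) (U V : zmodType)
    (psi : {additive (I -> U) -> V}) (D : {fset I}) (x : I -> U) :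
  (forall y, {in D, y =1 fun=> 0} -> psi y = 0) ->
  psi x = \sum_(i <- D) psi (single i (x i)).
Proof.
move=> psiD; apply/eqP; rewrite -raddf_sum -subr_eq0 -raddfB.
apply/eqP/psiD => i iD; rewrite addrfctE opprfctE fct_sumE.
rewrite (bigD1_seq i) ?fset_uniq //= {1}/single eqxx big1 ?addr0 ?subrr //.
by move=> j /negPf ji; rewrite /single eq_sym ji.
Qed.

Section Configurations.
Variables (K : fieldType) (G : groupType) (A : vectType K).
Implicit Types (S : set (G -> A)) (D E : {fset G}) (x y : G -> A) (g h : G).

Lemma shift1 x : shift 1%g x = x.
Proof. by apply/funext => g; rewrite /shift invg1 mul1g. Qed.

Lemma shiftM g h x : shift (g * h)%g x = shift g (shift h x).
Proof. by apply/funext => k; rewrite /shift invgM mulgA. Qed.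

Definition shift_invariant S : Prop := forall g x, S x -> S (shift g x).

Lemma prodiscrete_closedP S :
  prodiscrete_closed S <-> forall x, (forall E, saturation E S x) -> S x.
Proof.
split=> [clS x Sx|Ssat x clx].
  apply: clS => B /nbhs_prodiscreteP[E EB].
  by have [y [Sy yx]] := Sx E; exists y; split=> //; apply: EB.
by apply: Ssat => E; apply: clx; apply/nbhs_prodiscreteP; exists E.
Qed.

Lemma sftP S :
  shift_invariant S ->
  is_sft S <->
  exists D, forall x, (forall g, saturation D S (shift g x)) -> S x.
Proof.
move=> invS; split=> [[D [P SP]]|[D DS]].
  exists D => x xS; rewrite SP => g; have [y [+ yx]] := xS g^-1%g.
  rewrite SP => /(_ 1%g); rewrite invg1 shift1; congr P.
  by apply/funext => d; rewrite yx // fsvalP.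
exists D, [set q | exists2 y, S y & forall d : D, q d = y (val d)].
apply/seteqP; split=> [x Sx g|x xP].
  by exists (shift g^-1%g x) => //; apply: invS.
apply: DS => g; have [y Sy xy] := xP g^-1%g; exists y; split=> // h hD.
by have := xy [` hD]%fset; rewrite invgK => ->.
Qed.

Lemma linear_subshiftP S :
  linear_subshift S <->
  [/\ prodiscrete_closed S, shift_invariant S & submodule S].
Proof. by split=> [[? ? ? ? ?]|[? ? []]]; split. Qed.

End Configurations.

Definition ga_elt (K : fieldType) (G : groupType) (g : G) :
  group_algebra K G := (<< 1 *g g >> : {malg K[G]}).

Lemma ga_eltE (K : fieldType) (G : groupType) (a : group_algebra K G) :
  a = \sum_(g <- msupp a) mcoeff g a *: ga_elt K g.
Proof.
rewrite [LHS]monalgE; apply: eq_bigr => g _; apply/malgP => h.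
by rewrite mcoeffZ !mcoeffU mulrnAr mulr1.
Qed.

Section Pairing.
Variables (K : fieldType) (G : groupType).
Implicit Types (a b : group_algebra K G) (x : G -> K^o).

Definition pairing a x : K := mmap idfun x a.

Fact pairing_linearl x : scalar (pairing ^~ x).
Proof.
move=> c a b; rewrite /pairing raddfD /=; congr (_ + _).
rewrite (mmapEw (msuppZ_le _ _)) mmapE mulr_sumr.
by apply: eq_bigr => g _; rewrite mcoeffZ mulrA.
Qed.

Fact pairing_linearr a : scalar (pairing a).
Proof.
move=> c x y; rewrite /pairing !mmapE mulr_sumr -big_split.
by apply: eq_bigr => g _; rewrite /= mulrDr mulrCA.
Qed.

HB.instance Definition _ :=
  bilinear_isBilinear.Build K (group_algebra K G) (G -> K^o) K *%R *%R pairing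
    (pairing_linearl, pairing_linearr).

Lemma eq_pairing a x y : {in msupp a, x =1 y} -> pairing a x = pairing a y.
Proof. by move=> xy; apply: eq_big_seq => g /xy ->. Qed.

Lemma pairing_elt g x : pairing (ga_elt K g) x = x g.
Proof. by rewrite /pairing mmapU mul1r. Qed.

Lemma pairing_mul a b x :
  pairing (a * b) x =
  \sum_(g <- msupp a) mcoeff g a * pairing b (shift g^-1%g x).
Proof.
rewrite -[a * b]/(ga_mul a b) linear_sumlz; apply: eq_bigr => g _.
rewrite linear_sumlz mulr_sumr; apply: eq_bigr => h _.
by rewrite /= /pairing mmapU /shift invgK mulrA.
Qed.

End Pairing.

Section Duality.
Variables (K : fieldType) (G : groupType) (A : vectType K).

Let n : nat := \dim {:A}.
Let R := group_algebra K G.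
Let rows : lmodType K := restrict_scalars 'rV[R]_n.

Implicit Types (f : 'rV[R]_n) (x y : G -> A) (D : {fset G}).
Implicit Types (N : set 'rV[R]_n) (S : set (G -> A)).

Definition coordinate (i : 'I_n) x : G -> K^o :=
  fun g => coord (vbasis {:A}) i (x g).

Fact coordinate_linear i : linear (coordinate i).
Proof. by move=> c x y; apply/funext => g; rewrite /coordinate linearP. Qed.

HB.instance Definition _ i :=
  GRing.isLinear.Build K (G -> A) (G -> K^o) *:%R (coordinate i)
    (coordinate_linear i).

Definition row_pairing (f : rows) x : K :=
  \sum_i pairing (f 0 i) (coordinate i x).

Fact row_pairing_linearl x : scalar (row_pairing ^~ x).
Proof.
move=> c f f'; rewrite /row_pairing mulr_sumr -big_split.
by apply: eq_bigr => i _; rewrite !mxE mulr_algl linearPl.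
Qed.

Fact row_pairing_linearr f : scalar (row_pairing f).
Proof.
move=> c x y; rewrite /row_pairing mulr_sumr -big_split.
by apply: eq_bigr => i _; rewrite linearP linearPr.
Qed.

HB.instance Definition _ :=
  bilinear_isBilinear.Build K rows (G -> A) K *%R *%R row_pairing
    (row_pairing_linearl, row_pairing_linearr).

Lemma row_pairingZ (r : R) f x :
  row_pairing (r *: f) x =
  \sum_(g <- msupp r) mcoeff g r * row_pairing f (shift g^-1%g x).
Proof.
under [RHS]eq_bigr do rewrite mulr_sumr.
by rewrite exchange_big; apply: eq_bigr => i _; rewrite mxE pairing_mul.
Qed.

Lemma row_pairing_shift f g x :
  row_pairing f (shift g x) = row_pairing (ga_elt K g^-1%g *: f) x.
Proof.
by rewrite row_pairingZ msuppU oner_eq0 big_seq_fset1 mcoeffUU mul1r invgK.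
Qed.

Definition row_support f : {fset G} :=
  (\bigcup_(i <- enum 'I_n) msupp (f 0 i))%fset.

Lemma row_supportP f D :
  (row_support f `<=` D)%fset <->
  forall i g, g \notin D -> mcoeff g (f 0 i) = 0.
Proof.
split=> [/bigfcupsP fD i g gD|f0].
  apply/mcoeff_outdom; apply: contra gD; apply: (fsubsetP (fD i _ _)) => //.
  exact: mem_enum.
apply/bigfcupsP => i _ _; apply/fsubsetP => g.
by apply: contraLR => /(f0 i) fg; rewrite -mcoeff_eq0 fg.
Qed.

Lemma eq_row_pairing f x y :
  {in row_support f, x =1 y} -> row_pairing f x = row_pairing f y.
Proof.
move=> xy; apply: eq_bigr => i _; apply: eq_pairing => g gi.
rewrite /coordinate xy //.
exact: (fsubsetP (bigfcup_sup _ (mem_enum _ i) isT)).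
Qed.

Lemma local_functional_representation (psi : {scalar (G -> A)}) D :
  (forall x, {in D, x =1 fun=> 0} -> psi x = 0) ->
  exists2 f, (row_support f `<=` D)%fset & psi =1 row_pairing f.
Proof.
move=> psiD; pose b := vbasis {:A}.
pose f : 'rV[R]_n :=
  \row_i \sum_(d <- D) psi (single d b`_i) *: ga_elt K d.
exists f => [|x].
  apply/row_supportP => i g gD; rewrite mxE raddf_sum big_seq big1 //= => d dD.
  by rewrite mcoeffZ mcoeffU; case: eqP gD => [<-|_]; rewrite ?dD ?mulr0.
rewrite (additive_local_sum_single x psiD) /=.
under [RHS]eq_bigr do rewrite mxE linear_sumlz.
rewrite exchange_big; apply: eq_bigr => d _.
rewrite {1}(coord_vbasis (memvf (x d))) !linear_sum; apply: eq_bigr => i _ /=.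
by rewrite linearZl_LR !linearZ /= pairing_elt mulrC.
Qed.

Lemma row_functional_representation (phi : {scalar rows}) :
  exists x, phi =1 row_pairing ^~ x.
Proof.
pose e i g : rows := ga_elt K g *: delta_mx 0 i.
exists (fun g => \sum_i phi (e i g) *: (vbasis {:A})`_i) => f.
have fE : f = \sum_i \sum_(g <- msupp (f 0 i)) mcoeff g (f 0 i) *: e i g.
  rewrite [LHS]row_sum_delta; apply: eq_bigr => i _.
  rewrite [in LHS](ga_eltE (f 0 i)) scaler_suml; apply: eq_bigr => g _.
  by rewrite -mulr_algl -scalerA.
rewrite [in LHS]fE !linear_sum; apply: eq_bigr => i _.
rewrite linear_sum; apply: eq_bigr => g _ /=; rewrite linearZ; congr (_ * _).
rewrite /coordinate coord_sum_free //.
exact/basis_free/vbasisP.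
Qed.

Definition annihilator S : set 'rV[R]_n :=
  [set f | forall x, S x -> row_pairing f x = 0].

Definition zero_locus N : set (G -> A) :=
  [set x | forall f, N f -> row_pairing f x = 0].

Lemma submodule_annihilator S : shift_invariant S -> submodule (annihilator S).
Proof.
move=> invS; split=> [x _|f f' Nf Nf' x Sx|r f Nf x Sx].
- exact: linear0l.
- by rewrite linearDl /= Nf ?Nf' ?addr0.
- rewrite row_pairingZ big1 // => g _; rewrite Nf ?mulr0 //; exact: invS.
Qed.

Lemma linear_subshift_zero_locus N :
  submodule N -> linear_subshift (zero_locus N).
Proof.
move=> [_ _ NZ]; split=> [|g x Nx f Nf|f _|x y Nx Ny f Nf|c x Nx f Nf].
- apply/prodiscrete_closedP => x satx f Nf.
  have [y [Ny yx]] := satx (row_support f).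
  by rewrite -(Ny f Nf); apply: eq_row_pairing => g /yx.
- by rewrite row_pairing_shift; apply/Nx/NZ.
- exact: linear0r.
- by rewrite linearDr /= Nx ?Ny ?addr0.
- by rewrite linearZr_LR /= Nx ?mulr0.
Qed.

Lemma annihilator_zero_locus N :
  submodule N -> annihilator (zero_locus N) = N.
Proof.
move=> subN; apply/seteqP; split=> [f Nf|f Nf x]; last exact.
apply: contrapT => nNf.
have [phi phiN phif] :=
  exists_separating_functional (submodule_restrict subN) nNf.
have [x phiE] := row_functional_representation phi.
have /eqP : phi f = 0 by rewrite phiE; apply: Nf => f' /phiN; rewrite -phiE.
by rewrite phif oner_eq0.
Qed.

Lemma saturation_annihilator D S x :
  submodule S ->
  (forall f, (row_support f `<=` D)%fset -> annihilator S f ->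
     row_pairing f x = 0) ->
  saturation D S x.
Proof.
move=> subS Sx; apply: contrapT => nSx.
have [psi psiS psix] :=
  exists_separating_functional (submodule_saturation D subS) nSx.
have [y y0|f fD psiE] := @local_functional_representation psi D.
  by apply: psiS; exists 0; split=> [|g /y0->//]; case: subS.
have /eqP : psi x = 0.
  rewrite psiE; apply: Sx => // y Sy; rewrite -psiE.
  exact/psiS/sub_saturation.
by rewrite psix oner_eq0.
Qed.

Definition row_mcoeff (k : 'I_n * G) (f : rows) : K^o := mcoeff k.2 (f 0 k.1).

Fact row_mcoeff_linear k : linear (row_mcoeff k).
Proof.
by move=> c f f'; rewrite /row_mcoeff !mxE mulr_algl mcoeffD mcoeffZ.
Qed.

HB.instance Definition _ k :=
  GRing.isLinear.Build K rows K^o *:%R (row_mcoeff k) (row_mcoeff_linear k).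

Lemma submodule_supported D :
  submodule ([set f | (row_support f `<=` D)%fset] : set rows).
Proof.
split=> [|f f' /row_supportP fD /row_supportP f'D|c f /row_supportP fD];
  apply/row_supportP => i g gD.
- by rewrite mxE mcoeff0.
- by rewrite mxE mcoeffD fD ?f'D ?addr0.
- by rewrite mxE mulr_algl mcoeffZ fD ?mulr0.
Qed.

Lemma finitely_generated_supported (N : set rows) D :
  submodule N ->
  finitely_generated (N `&` [set f | (row_support f `<=` D)%fset]).
Proof.
move=> subN; pose ks := [seq (i, g) | i <- enum 'I_n, g <- D].
apply: (@finitely_generated_coords _ _ _ row_mcoeff ks).
- exact: noetherian_field.
- by apply: submoduleI => //; apply: submodule_supported.
move=> f [_ /row_supportP fD] f0; apply/rowP => i; rewrite mxE.
apply/malgP => g; rewrite mcoeff0.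
have [gD|/(fD i)//] := boolP (g \in D); apply: (f0 (i, g)).
by apply/allpairsP; exists (i, g); rewrite mem_enum.
Qed.

(* The submodule J generated by the equations supported in the window D of S has
   zero locus contained in S, hence J contains every equation of S. *)
Lemma sft_finitely_generated S :
  linear_subshift S -> is_sft S -> finitely_generated (annihilator S).
Proof.
move=> /linear_subshiftP[_ invS subS] /(sftP invS)[D DS].
have subN := submodule_annihilator invS.
have [s sE] := finitely_generated_supported D (submodule_restrict subN).
exists s; set J := smallest _ _.
have subJ : submodule J := submodule_smallest _.
have sN : [set` s] `<=` annihilator S.
  apply: (@subset_trans _ (smallest submodule ([set` s] : set rows))) => //.
  by rewrite -sE; apply: subIsetl.
apply/seteqP; split; last exact: smallest_sub.
rewrite -(annihilator_zero_locus subJ).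
suff JS : zero_locus J `<=` S by move=> f Nf x /JS; apply: Nf.
move=> x Jx; apply: DS => g; apply: saturation_annihilator => // f fD Nf.
have [_ invJ _ _ _] := linear_subshift_zero_locus subJ.
apply: (invJ g x Jx); have : smallest submodule ([set` s] : set rows) f.
  by rewrite -sE.
by apply: smallest_sub; [apply: submodule_restrict|apply: sub_gen_smallest].
Qed.

Lemma finitely_generated_sft S :
  linear_subshift S -> finitely_generated (annihilator S) -> is_sft S.
Proof.
move=> /linear_subshiftP[clS invS subS] [s sE]; apply/(sftP invS).
pose D := (\bigcup_(f <- s) row_support f)%fset; exists D => x satx.
apply/(prodiscrete_closedP S).1 => // E.
apply: saturation_annihilator => // f _ Nf.
pose orbit := range (fun g => shift g x).
have orbit_inv : shift_invariant orbit.
  by move=> g _ [h _ <-]; exists (g * h)%g; rewrite ?shiftM.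
suff : annihilator S `<=` annihilator orbit.
  by move=> /(_ f Nf); apply; exists 1%g; rewrite ?shift1.
rewrite sE; apply: smallest_sub; first exact: submodule_annihilator.
move=> t ts _ [g _ <-]; have [y [Sy yx]] := satx g.
have Nt : annihilator S t by rewrite sE; apply: sub_gen_smallest.
rewrite -(Nt y Sy); apply/esym/eq_row_pairing => h ht; apply: yx.
exact: (fsubsetP (bigfcup_sup _ ts isT)).
Qed.

Lemma linear_subshifts_sftP :
  (forall S, linear_subshift S -> is_sft S) <->
  noetherian_module 'rV[R]_n.
Proof.
split=> [sft N subN|noeth S linS].
  have linS := linear_subshift_zero_locus subN.
  rewrite -(annihilator_zero_locus subN).
  by apply: sft_finitely_generated => //; apply: sft.
apply: finitely_generated_sft => //; apply/noeth/submodule_annihilator.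
by have /linear_subshiftP[] := linS.
Qed.

End Duality.

Lemma linear_markov_typeP (K : fieldType) (G : groupType) :
  linear_markov_type K G <-> left_noetherian (group_algebra K G).
Proof.
rewrite left_noetherianP; split=> [markov|noeth A S].
  have dimK : (0 < \dim {:K^o})%N by rewrite dimvf.
  apply: (noetherian_row_entry (Ordinal dimK)).
  by apply/linear_subshifts_sftP => S; apply: markov.
by apply: (linear_subshifts_sftP G A).2; apply: noetherian_row.
Qed.

Theorem theorem1p3 (K : fieldType) (G : groupType)
    (countable_G : countable [set: G]%classic) :
  one_sided_noetherian (group_algebra K G) <-> linear_markov_type K G.
Proof.
rewrite linear_markov_typeP; split; last by left.
by case=> // /group_algebra_left_right_noetherian.
Qed.
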